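(* Let $x>0$. Then \[ \frac{\Gamma(x+1/2)}{\Gamma(x+1)}<\sqrt{\frac{2}{\pi}}\,\mathrm{e}^{x}K_0(x). \]
   Context: $x$ is real. $K_0(x)$ denotes the modified Bessel function of the second kind of order $0$, which for $x>0$ is given by $K_0(x)=\int_0^\infty \mathrm{e}^{-x\cosh s}\,\mathrm{d}s$. $\Gamma$ is the gamma function. *)

(* Defs.v *)
From mathcomp Require Import all_boot all_order all_algebra.
From mathcomp Require Import all_classical all_reals all_analysis.

Set Implicit Arguments.
Unset Strict Implicit.
Unset Printing Implicit Defensive.

Import Order.TTheory GRing.Theory Num.Theory.
Import numFieldNormedType.Exports.

Local Open Scope classical_set_scope.
Local Open Scope ring_scope.

Definition cosh (R : realType) (s : R) : R := (expR s + expR (- s)) / 2.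

(* Euler's integral of the second kind: the Gamma function for 0 < a only
   (for a <= 0 the integral diverges and Rintegral returns 0). *)
Definition Gamma (R : realType) (a : R) : R :=
  \int[@lebesgue_measure R]_(t in `]0, +oo[) (t `^ (a - 1) * expR (- t)).

(* Modified Bessel function of the second kind of order 0, for 0 < x only
   (for x <= 0 the integral diverges and Rintegral returns 0). *)
Definition besselK0 (R : realType) (x : R) : R :=
  \int[@lebesgue_measure R]_(s in `[0, +oo[) expR (- x * cosh s).

(* Main.v *)
Require Import Defs.
From mathcomp Require Import all_boot all_order all_algebra.
From mathcomp Require Import all_classical all_reals all_analysis.
From mathcomp Require Import measurable_realfun gauss_integral ring lra.

Import Order.TTheory GRing.Theory Num.Theory.
Import numFieldNormedType.Exports.

Local Open Scope ring_scope.

(** Both sides are compared with the Wallis integral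
      J = int_0^oo (1 + v^2)^-(x + 1) dv.

    The left side is an exact multiple of J. Writing (1 + v^2)^-a Gamma(a) as
    int_0^oo t^(a - 1) e^(-(1 + v^2) t) dt and exchanging the two integrations
    leaves a Gaussian integral in v, equal to sqrt(pi) / (2 sqrt t); what
    remains in t is Gamma(a - 1/2). With a = x + 1 this gives
      Gamma(x + 1) J = (sqrt pi / 2) Gamma(x + 1/2)       ([gammaE_wallis]).

    The right side dominates J pointwise after a change of variable. Let
    c = cosh s - 1, so that e^x K_0(x) = int_0^oo e^(-x c) ds. The substitution
    1 + v^2 = e^c turns J into
      int_0^oo e^(-x c) sinh s / (2 sqrt (e^c - 1)) ds         ([wallis_vcosh]).
    Since sinh^2 s = 2 c + c^2 = 2 (c + c^2 / 2) < 2 (e^c - 1), the factor of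
    e^(-x c) is smaller than 1 / sqrt 2 ([sinh_vcosh_lt]), hence
      J < e^x K_0(x) / sqrt 2                            ([wallis_lt_besselK0]).
    Combining the two gives the claim, as
    (2 / sqrt pi) (1 / sqrt 2) = sqrt (2 / pi).

    The integrals are manipulated as extended real numbers, where Tonelli's
    theorem and monotone convergence hold unconditionally for nonnegative
    functions; finiteness is established only for K_0, by a Gaussian bound. *)

(** * Substitution on the open half-line *)

Section substitution_oy.
Context {R : realType}.
Local Open Scope classical_set_scope.
Let mu := @lebesgue_measure R.
Implicit Types (F f G : R -> R) (a b s t v : R).

Lemma measurable_fun_continuous_oy G :
  (forall x : R, 0 < x -> {for x, continuous G}) ->
  measurable_fun (`]0%R, +oo[ : set R) G.
Proof.
move=> cG; apply: open_continuous_measurable_fun; first exact: interval_open.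
by move=> x; rewrite inE/= in_itv/= andbT; exact: cG.
Qed.

(** On a segment away from 0 the derivative has one-sided limits at both
    endpoints, as the substitution theorem for segments demands, even when it
    has none at 0 or at infinity. *)
Lemma integration_by_substitution_segment F f G a b : 0 < a -> a < b ->
  (forall s t : R, 0 < s -> s < t -> F s < F t) ->
  (forall s : R, 0 < s -> is_derive s 1 F (f s)) ->
  (forall s : R, 0 < s -> {for s, continuous f}) ->
  {within `[F a, F b], continuous G} ->
  (\int[mu]_(v in `[F a, F b]) (G v)%:E =
   \int[mu]_(s in `[a, b]) (G (F s) * f s)%:E)%E.
Proof.
move=> a0 ab homoF dF cf cG.
have F'f s : 0 < s -> F^`() s = f s.
  by move=> s0; rewrite derive1E; have d := dF _ s0; rewrite derive_val.
have cF' s : 0 < s -> F^`() x @[x --> s] --> f s.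
  move=> s0; apply: cvg_trans (cf _ s0).
  apply: near_eq_cvg; near=> x; apply/esym/F'f; near: x.
  exact: lt_nbhsr.
have cF s : 0 < s -> F x @[x --> s] --> F s.
  move=> s0; apply: differentiable_continuous.
  by apply/derivable1_diffP; have := dF _ s0; case.
have b0 := lt_trans a0 ab.
rewrite (@integration_by_substitution_increasing _ F G a b (ltW ab)) //.
- apply: eq_integral => s; rewrite inE/= in_itv/= => /andP[as_ _].
  by congr ((G (F s)) * _)%:E; apply: F'f; exact: lt_le_trans as_.
- by move=> s t; rewrite !in_itv/= => /andP[/(lt_le_trans a0)]; auto.
- move=> s; rewrite in_itv/= => /andP[/(lt_trans a0) s0 _].
  by rewrite /continuous_at F'f//; exact: cF'.
- by apply/cvg_ex; exists (f a); apply: cvg_at_right_filter; exact: cF'.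
- by apply/cvg_ex; exists (f b); apply: cvg_at_left_filter; exact: cF'.
- split.
  + move=> s; rewrite in_itv/= => /andP[/(lt_trans a0) s0 _].
    by have := dF _ s0; case.
  + by apply: cvg_at_right_filter; exact: cF.
  + by apply: cvg_at_left_filter; exact: cF.
Unshelve. all: by end_near.
Qed.

Lemma bigcup_segments (a b : nat -> R) :
  (forall n, 0 < a n) -> a @ \oo --> (0 : R) -> b @ \oo --> +oo ->
  {homo a : m n / (m <= n)%N >-> n <= m} ->
  {homo b : m n / (m <= n)%N >-> m <= n} ->
  \bigcup_n `[a n, b n] = `]0, +oo[.
Proof.
move=> a0 aN0 boo ha hb; apply/seteqP; split => x /=.
  by move=> [n _]/=; rewrite !in_itv/= andbT => /andP[+ _]; exact: lt_le_trans.
rewrite in_itv/= andbT => x0.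
have [n _ an] := cvgr_lt _ aN0 _ x0.
have [m _ bm] : \forall n \near \oo, x <= b n.
  by move/cvgryPge : boo; apply.
exists (maxn m n) => //=.
by rewrite in_itv/= bm/= ?leq_maxl// ltW// an/= ?leq_maxr.
Qed.

Lemma cvg_integral_segments (c d : nat -> R) G :
  (forall n, 0 < c n) -> c @ \oo --> (0 : R) -> d @ \oo --> +oo ->
  {homo c : m n / (m <= n)%N >-> n <= m} ->
  {homo d : m n / (m <= n)%N >-> m <= n} ->
  (forall v : R, 0 < v -> {for v, continuous G}) ->
  (forall v : R, 0 < v -> 0 <= G v) ->
  (\int[mu]_(v in `[c n, d n]) (G v)%:E @[n --> \oo] -->
   \int[mu]_(v in `]0%R, +oo[) (G v)%:E)%E.
Proof.
move=> c0 cN0 doo hc hd cG G0.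
have sub i : `[c i, d i] `<=` `]0%R, +oo[.
  move=> x/=; rewrite !in_itv/= andbT => /andP[+ _].
  exact: lt_le_trans.
rewrite -(bigcup_segments c d)//.
apply: ge0_nondecreasing_set_cvg_integral => //.
- move=> m n mn; rewrite subsetEset; apply: subset_itv; rewrite bnd_simp.
    exact: hc.
  exact: hd.
- move=> i; apply: (measurable_funS _ (sub i)) => //.
  by apply/measurable_EFinP; apply: measurable_fun_continuous_oy.
- by move=> i x /sub/=; rewrite in_itv/= andbT lee_fin; exact: G0.
Qed.

(** Neither the derivative [f] nor the integrand [G] needs a limit at the ends
    of the half-line: the identity holds on the segments [1/(n+1), n+2], and
    both sides converge monotonically. This matters for [vcosh], whose
    derivative is unbounded at infinity. *)
Lemma ge0_integration_by_substitution_oy F f G :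
  (forall s : R, 0 < s -> 0 < F s) ->
  (forall s t : R, 0 < s -> s < t -> F s < F t) ->
  (forall s : R, 0 < s -> is_derive s 1 F (f s)) ->
  (forall s : R, 0 < s -> {for s, continuous f}) ->
  (forall s : R, 0 < s -> 0 <= f s) ->
  F s @[s --> 0^'+] --> 0 -> F s @[s --> +oo] --> +oo ->
  (forall v : R, 0 < v -> {for v, continuous G}) ->
  (forall v : R, 0 < v -> 0 <= G v) ->
  (\int[mu]_(v in `]0%R, +oo[) (G v)%:E =
   \int[mu]_(s in `]0%R, +oo[) (G (F s) * f s)%:E)%E.
Proof.
move=> Fpos homoF dF cf f0 F0 Foo cG G0.
pose a n : R := n.+1%:R^-1.
pose b n : R := n.+2%:R.
have a0 n : 0 < a n by rewrite invr_gt0.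
have b0 n : 0 < b n by rewrite ltr0n.
have ab n : a n < b n.
  by rewrite (@le_lt_trans _ _ 1)// ?ltr1n// invf_le1// ler1n.
have aN0 : a @ \oo --> (0 : R) by exact: cvg_harmonic.
have boo : b @ \oo --> +oo.
  rewrite (_ : b = fun n => (n + 2)%:R).
    by rewrite (cvg_shiftn 2 (fun n => n%:R : R) +oo); exact: cvgr_idn.
  by apply/funext => n; rewrite addn2.
have ha : {homo a : m n / (m <= n)%N >-> n <= m}.
  by move=> m n mn; rewrite lef_pV2 ?posrE// ler_nat.
have hb : {homo b : m n / (m <= n)%N >-> m <= n}.
  by move=> m n mn; rewrite ler_nat.
have hF x y : 0 < x -> x <= y -> F x <= F y.
  move=> x0; rewrite le_eqVlt => /predU1P[->//|xy].
  exact/ltW/homoF.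
have cF s : 0 < s -> {for s, continuous F}.
  move=> s0; apply: differentiable_continuous.
  by apply/derivable1_diffP; have := dF _ s0; case.
have cGF s : 0 < s -> {for s, continuous (fun s => G (F s) * f s)}.
  move=> s0; apply: cvgM; last exact: cf.
  by apply: continuous_comp; [exact: cF|exact/cG/Fpos].
have Fa0 : (F \o a) @ \oo --> (0 : R).
  by move/cvg_at_rightP : F0; apply; split.
have lhs :
  (\int[mu]_(v in `[(F \o a) n, (F \o b) n]) (G v)%:E @[n --> \oo] -->
    \int[mu]_(v in `]0%R, +oo[) (G v)%:E)%E.
  apply: cvg_integral_segments => //.
  - by move=> n; exact: Fpos.
  - exact: (cvg_comp b F boo Foo).
  - by move=> m n mn; apply: hF => //; exact: ha.
  - by move=> m n mn; apply: hF => //; exact: hb.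
have rhs := cvg_integral_segments a b _ a0 aN0 boo ha hb cGF
  (fun s (s0 : 0 < s) => mulr_ge0 (G0 _ (Fpos _ s0)) (f0 s s0)).
rewrite -(cvg_lim _ lhs)// -(cvg_lim _ rhs)//; congr (limn _).
apply/funext => n /=; apply: integration_by_substitution_segment => //.
apply: continuous_in_subspaceT => x; rewrite inE/= in_itv/= => /andP[Fx _].
exact/cG/(lt_le_trans (Fpos _ (a0 n))).
Unshelve. all: by end_near.
Qed.

End substitution_oy.

(** * The Wallis integral as a ratio of Gamma values *)

Lemma fubini_tonelli_in d1 d2 (T1 : measurableType d1) (T2 : measurableType d2)
    (R : realType) (m1 : {sigma_finite_measure set T1 -> \bar R})
    (m2 : {sigma_finite_measure set T2 -> \bar R}) (D1 : set T1) (D2 : set T2)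
    (f : T1 * T2 -> \bar R) : measurable D1 -> measurable D2 ->
  measurable_fun (D1 `*` D2)%classic f ->
  (forall x y, D1 x -> D2 y -> 0 <= f (x, y))%E ->
  (\int[m1]_(x in D1) \int[m2]_(y in D2) f (x, y) =
   \int[m2]_(y in D2) \int[m1]_(x in D1) f (x, y))%E.
Proof.
move=> mD1 mD2 mf f0; pose g := f \_ (D1 `*` D2)%classic.
have mg : measurable_fun setT g.
  by apply/(measurable_restrictT f) => //; exact: measurableX.
have g0 z : (0 <= g z)%E.
  by apply: erestrict_ge0 => -[x y] [/= xD1 yD2]; exact: f0.
have gE := fubini_tonelli (m1 := m1) (m2 := m2) g mg g0.
rewrite integral_mkcond [RHS]integral_mkcond.
transitivity (\int[m1]_x \int[m2]_y g (x, y))%E.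
  apply: eq_integral => x _; rewrite patchE integral_mkcond.
  case: ifPn => xD1; last first.
    rewrite integral0_eq// => y _; rewrite /g patchE in_setX /=.
    by rewrite (negbTE xD1).
  apply: eq_integral => y _.
  by rewrite /g !patchE in_setX /= xD1.
rewrite gE; apply: eq_integral => y _; rewrite patchE.
case: ifPn => yD2; last first.
  rewrite integral0_eq// => x _; rewrite /g patchE in_setX /=.
  by rewrite (negbTE yD2) andbF.
rewrite [RHS]integral_mkcond; apply: eq_integral => x _.
by rewrite /g !patchE in_setX /= yD2 andbT.
Qed.

Section gamma_wallis.
Context {R : realType}.
Local Open Scope classical_set_scope.
Let mu := @lebesgue_measure R.
Implicit Types (F f G : R -> R) (a b s t v : R).

Lemma continuous_powR a t : 0 < t -> {for t, continuous (fun u : R => u `^ a)}.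
Proof.
move=> t0; apply: differentiable_continuous; apply/derivable1_diffP.
by have := is_derive1_powR a t0; case.
Qed.

Lemma integral_oy_dilation G (k : R) : 0 < k ->
  (forall v : R, 0 < v -> {for v, continuous G}) ->
  (forall v : R, 0 < v -> 0 <= G v) ->
  (\int[mu]_(v in `]0%R, +oo[) (G v)%:E =
   k%:E * \int[mu]_(v in `]0%R, +oo[) (G (k * v))%:E)%E.
Proof.
move=> k0 cG G0.
have dF s : 0 < s -> is_derive s 1 ( *%R k) (cst k s).
  move=> _; have d := is_deriveZ k (is_derive_id s 1).
  by rewrite -[cst k s]mulr1; exact: d.
rewrite (ge0_integration_by_substitution_oy ( *%R k) (cst k) G _ _ dF)//.
- rewrite -ge0_integralZl//.
  + by apply: eq_integral => v _; rewrite -EFinM mulrC.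
  + apply/measurable_EFinP; apply: measurable_fun_continuous_oy => v v0.
    apply: continuous_comp; first exact: mulrl_continuous.
    by apply: cG; rewrite mulr_gt0.
  + by move=> v/=; rewrite in_itv/= andbT => v0; rewrite lee_fin G0// mulr_gt0.
  + by rewrite lee_fin ltW.
- by move=> v v0; rewrite mulr_gt0.
- by move=> s t _ st; rewrite ltr_pM2l.
- by move=> s _; exact: cvg_cst.
- by move=> *; exact: ltW.
- rewrite -[X in _ --> X](mulr0 k); apply: cvg_at_right_filter.
  exact: mulrl_continuous.
- exact: gt0_cvgMry.
Qed.

(** Euler's integral with values in the extended reals, so that identities about
    it need no convergence hypothesis. *)
Definition gammaE a : \bar R :=
  (\int[mu]_(t in `]0%R, +oo[) (t `^ (a - 1) * expR (- t))%:E)%E.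

Lemma GammaE a : Gamma a = fine (gammaE a).
Proof. by []. Qed.

Lemma gamma_integrand_continuous a t : 0 < t ->
  {for t, continuous (fun t : R => t `^ a * expR (- t))}.
Proof.
move=> t0; apply: cvgM; first exact: continuous_powR.
by apply: continuous_comp; [exact: continuousN|exact: continuous_expR].
Qed.

Lemma gammaE_scale a (k : R) : 0 < k ->
  (\int[mu]_(t in `]0%R, +oo[) (t `^ (a - 1) * expR (- (k * t)))%:E =
   (k `^ (- a))%:E * gammaE a)%E.
Proof.
move=> k0; rewrite /gammaE.
rewrite (integral_oy_dilation
  (fun t : R => t `^ (a - 1) * expR (- t)) k)//; last 2 first.
- by move=> v v0; exact: gamma_integrand_continuous.
- by move=> v _; rewrite mulr_ge0 ?powR_ge0 ?expR_ge0.
rewrite muleA -EFinM -ge0_integralZl//=.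
- apply: eq_integral => t; rewrite inE/= in_itv/= andbT => t0.
  rewrite -EFinM powRM ?ltW// !mulrA.
  rewrite (_ : k `^ (- a) * k * k `^ (a - 1) = 1) ?mul1r//.
  rewrite -[X in _ * X * _]powRr1 ?ltW// -!powRD ?(gt_eqF k0) ?implybT//.
  by rewrite (_ : - a + 1 + (a - 1) = 0) ?powRr0//; ring.
- apply/measurable_EFinP; apply: measurable_fun_continuous_oy => v v0.
  apply: (@continuous_comp _ _ _ ( *%R k) (fun t => t `^ (a - 1) * expR (- t))).
    exact: mulrl_continuous.
  by apply: gamma_integrand_continuous; rewrite mulr_gt0.
- by move=> v _; rewrite lee_fin mulr_ge0 ?powR_ge0 ?expR_ge0.
- by rewrite lee_fin mulr_ge0 ?powR_ge0 ?ltW.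
Qed.

Lemma gauss_scale t : 0 < t ->
  (\int[mu]_(v in `]0%R, +oo[) (expR (- (t * v ^+ 2)))%:E =
   (Num.sqrt pi / 2 * t `^ (- 2^-1))%:E)%E.
Proof.
move=> t0; have rt0 : 0 < Num.sqrt t by rewrite sqrtr_gt0.
have := @integral0y_gauss R; rewrite -integral_itv_obnd_cbnd; last first.
  by apply/measurable_EFinP/measurable_funTS; exact: measurable_gauss_fun.
rewrite (integral_oy_dilation (@gauss_fun R) (Num.sqrt t))//; last 2 first.
- by move=> v _; exact: continuous_gauss_fun.
- by move=> v _; exact: gauss_fun_ge0.
under eq_integral do rewrite /gauss_fun exprMn sqr_sqrtr ?ltW//.
move=> e; rewrite mulrC EFinM -e muleA -EFinM powRN -powR12_sqrt ?ltW//.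
by rewrite mulVf ?mul1e// gt_eqF// powR_gt0.
Qed.

(** The substitution v = tan u identifies this with the integral of
    cos^(2 a - 2) over [0, pi / 2]. *)
Definition wallis a : \bar R :=
  (\int[mu]_(v in `]0%R, +oo[) ((1 + v ^+ 2) `^ (- a))%:E)%E.

(** Euler's relation Gamma(a) B(a - 1/2, 1/2) = Gamma(a - 1/2) Gamma(1/2) in
    disguise: Tonelli applied to t^(a - 1) e^(-(1 + v^2) t), whose integral in t
    is a dilated Gamma integral and whose integral in v is a dilated Gaussian. *)
Lemma gammaE_wallis a :
  (gammaE a * wallis a = (Num.sqrt pi / 2)%:E * gammaE (a - 2^-1))%E.
Proof.
rewrite /wallis.
have k0 v : 0 < 1 + v ^+ 2 by rewrite ltr_wpDr ?sqr_ge0.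
have mk : measurable_fun (`]0%R, +oo[ : set R)
    (fun v : R => (1 + v ^+ 2) `^ (- a)).
  by apply: (measurableT_comp (measurable_powR _)); apply: measurable_funD.
have g0 b : (0 <= gammaE b)%E.
  by apply: integral_ge0 => t _; rewrite lee_fin mulr_ge0 ?powR_ge0 ?expR_ge0.
rewrite -ge0_integralZl//; first last.
- by move=> v _; rewrite lee_fin powR_ge0.
- exact/measurable_EFinP.
transitivity (\int[mu]_(v in `]0%R, +oo[) \int[mu]_(t in `]0%R, +oo[)
   (t `^ (a - 1) * expR (- ((1 + v ^+ 2) * t)))%:E)%E.
  by apply: eq_integral => v _; rewrite gammaE_scale// muleC.
rewrite (fubini_tonelli_in _ _ _ _ _ mu mu _ _ (fun z : R * R =>
  (z.2 `^ (a - 1) * expR (- ((1 + z.1 ^+ 2) * z.2)))%:E))//; last 2 first.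
- apply/measurable_EFinP/measurable_funTS/measurable_funM.
    by apply: (measurableT_comp (measurable_powR _)).
  apply: measurableT_comp => //; apply: measurableT_comp => //.
  apply: measurable_funM => //; apply: measurable_funD => //.
  exact: (measurable_funX 2).
- by move=> v t _ _; rewrite lee_fin mulr_ge0 ?powR_ge0 ?expR_ge0.
rewrite -ge0_integralZl//; first last.
- by move=> v _; rewrite lee_fin mulr_ge0 ?powR_ge0 ?expR_ge0.
- apply/measurable_EFinP; apply: measurable_fun_continuous_oy => t t0.
  exact: gamma_integrand_continuous.
apply: eq_integral => t; rewrite inE/= in_itv/= andbT => t0.
transitivity ((t `^ (a - 1) * expR (- t))%:E *
  \int[mu]_(v in `]0%R, +oo[) (expR (- (t * v ^+ 2)))%:E)%E.
  rewrite -ge0_integralZl//.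
  - apply: eq_integral => v _; rewrite -EFinM -mulrA -expRD.
    by congr (_ * expR _)%:E; ring.
  - apply/measurable_EFinP/measurableT_comp => //; apply: measurableT_comp => //.
    apply: measurable_funM => //; exact: exprn_measurable.
  - by rewrite lee_fin mulr_ge0 ?powR_ge0 ?expR_ge0.
rewrite gauss_scale// -!EFinM; congr (_%:E).
rewrite (_ : a - 2^-1 - 1 = (a - 1) + (- 2^-1)); last by ring.
by rewrite (@powRD _ t (a - 1)) ?(gt_eqF t0) ?implybT//; ring.
Qed.

End gamma_wallis.

(** * The Wallis integral below the Bessel function *)

(** If the integrals were equal, [g - f], nonnegative with integral 0, would
    vanish almost everywhere on [D], making [D] negligible. *)
Lemma lt_integral d (T : measurableType d) (R : realType)
    (m : {measure set T -> \bar R}) (D : set T) (f g : T -> R) :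
  measurable D -> (0 < m D)%E ->
  measurable_fun D f -> measurable_fun D g ->
  (forall x, D x -> 0 <= f x < g x) ->
  (\int[m]_(x in D) (g x)%:E < +oo)%E ->
  (\int[m]_(x in D) (f x)%:E < \int[m]_(x in D) (g x)%:E)%E.
Proof.
move=> mD D0 mf mg fg gfin.
have f0 x : D x -> 0 <= f x by move=> /fg/andP[].
have gf0 x : D x -> 0 < g x - f x by move=> /fg/andP[_]; rewrite subr_gt0.
have mgf : measurable_fun D (fun x => (g x - f x)%:E).
  by apply/measurable_EFinP; exact: measurable_funB.
have gE : (\int[m]_(x in D) (g x)%:E =
    \int[m]_(x in D) (f x)%:E + \int[m]_(x in D) (g x - f x)%:E)%E.
  rewrite -ge0_integralD//.
  - by apply: eq_integral => x _; rewrite -EFinD subrKC.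
  - by apply/measurable_EFinP.
  - by move=> x Dx; rewrite lee_fin ltW// gf0.
have f0' : (0 <= \int[m]_(x in D) (f x)%:E)%E.
  by apply: integral_ge0 => x Dx; rewrite lee_fin f0.
have gfge0 : (0 <= \int[m]_(x in D) (g x - f x)%:E)%E.
  by apply: integral_ge0 => x Dx; rewrite lee_fin ltW// gf0.
rewrite gE lteDl.
  rewrite lt_neqAle gfge0 andbT; apply/eqP => /esym i0.
  have : (\int[m]_(x in D) `|(g x - f x)%:E| = 0)%E.
    rewrite -[RHS]i0; apply: eq_integral => x; rewrite inE => Dx.
    by rewrite gee0_abs// lee_fin ltW// gf0.
  move/(ae_eq_integral_abs m mD mgf) => -[N [mN N0 DN]].
  have : (m D <= m N)%E.
    apply: le_measure; rewrite ?inE// => x Dx; apply: DN => /(_ Dx)/= [] e.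
    by have := gf0 _ Dx; rewrite e ltxx.
  by rewrite N0 leNgt D0.
rewrite ge0_fin_numE//; apply: le_lt_trans gfin; rewrite gE.
exact: leeDl.
Qed.

Section wallis_bessel.
Context {R : realType}.
Local Open Scope classical_set_scope.
Let mu := @lebesgue_measure R.
Implicit Types (s t x : R).

Definition sinh s : R := (expR s - expR (- s)) / 2.

Lemma is_derive_cosh s : is_derive s 1 (@cosh R) (sinh s).
Proof.
rewrite /cosh; apply: is_derive_eq.
by rewrite /sinh /GRing.scale/=; ring.
Qed.

Lemma sqr_sinh s : sinh s ^+ 2 = (cosh s - 1) ^+ 2 + 2 * (cosh s - 1).
Proof.
rewrite /sinh /cosh expRN; field.
by rewrite gt_eqF ?expR_gt0.
Qed.

Lemma sinh_gt0 s : 0 < s -> 0 < sinh s.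
Proof. by move=> s0; rewrite divr_gt0// subr_gt0 ltr_expR; lra. Qed.

Lemma lt_cosh s t : 0 < s -> s < t -> cosh s < cosh t.
Proof.
move=> s0 st; rewrite /cosh !expRN ltr_pM2r//.
have a1 : 1 < expR s by rewrite expR_gt1.
have ab : expR s < expR t by rewrite ltr_expR.
set a := expR s in a1 ab *; set b := expR t in ab *.
rewrite -subr_gt0.
(* w + 1/w increases for w > 1. *)
have -> : b + b^-1 - (a + a^-1) = (b - a) * (1 - (a * b)^-1).
  field; apply/andP; split; apply/eqP; lra.
apply: mulr_gt0; first by rewrite subr_gt0.
rewrite subr_gt0 invf_lt1; nra.
Qed.

(** The first four terms of the series; the cubic one makes the bound strict. *)
Lemma expR_gt_quadratic s : 0 < s -> 1 + s + s ^+ 2 / 2 < expR s.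
Proof.
move=> s0.
have h : series (exp_coeff s) 4 <= expR s.
  apply: nondecreasing_cvgn_le; last exact: is_cvg_series_exp_coeff.
  by apply: nondecreasing_series => n _ _; exact/exp_coeff_ge0/ltW.
apply: lt_le_trans h.
rewrite /series/= !big_nat_recr//= big_geq// /exp_coeff/=.
rewrite !factS fact0 expr0 expr1 !muln1 add0r !divr1 ltrDl.
by rewrite divr_gt0 ?exprn_gt0.
Qed.

(** From cosh s - 1 = 2 sinh^2 (s / 2) and the crude bound
    e^u - e^-u >= u for u = s / 2. The constant 1/8 instead of the optimal 1/2
    suffices for convergence at infinity. *)
Lemma cosh_sub1_ge s : 0 <= s -> s ^+ 2 / 8 <= cosh s - 1.
Proof.
move=> s0; rewrite /cosh.
have -> : expR s = expR (s / 2) ^+ 2 by rewrite -expRM_natl; congr expR; field.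
have -> : expR (- s) = expR (s / 2) ^- 2.
  by rewrite expRN -expRM_natl; congr (expR _)^-1; field.
have h := expR_ge1Dx (s / 2).
set e := expR (s / 2) in h *.
have e0 : 0 < e by exact: expR_gt0.
have -> : (e ^+ 2 + e ^- 2) / 2 - 1 = (e - e^-1) ^+ 2 / 2.
  by field; rewrite gt_eqF.
have : e^-1 <= 1 by rewrite invf_le1//; lra.
nra.
Qed.

Lemma cosh_sub1_gt0 s : 0 < s -> 0 < cosh s - 1.
Proof.
move=> s0; apply: lt_le_trans (cosh_sub1_ge _ (ltW s0)).
by rewrite divr_gt0// exprn_gt0.
Qed.

(** The change of variable v = sqrt (e^(cosh s - 1) - 1) is chosen so that the
    power (1 + v^2)^-x becomes the Bessel integrand e^(-x (cosh s - 1)). *)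
Definition vcosh s : R := Num.sqrt (expR (cosh s - 1) - 1).

Lemma sqr_vcosh s : 0 <= s -> vcosh s ^+ 2 = expR (cosh s - 1) - 1.
Proof.
move=> s0; rewrite sqr_sqrtr// subr_ge0 -[leLHS]expR0 ler_expR.
by apply: le_trans (cosh_sub1_ge _ s0); rewrite divr_ge0// sqr_ge0.
Qed.

Lemma vcosh_gt0 s : 0 < s -> 0 < vcosh s.
Proof. by move=> s0; rewrite sqrtr_gt0 subr_gt0 expR_gt1 cosh_sub1_gt0. Qed.

Definition vcosh' s : R := expR (cosh s - 1) * sinh s / (2 * vcosh s).

Lemma is_derive_vcosh s : 0 < s -> is_derive s 1 vcosh (vcosh' s).
Proof.
move=> s0; have dc := is_derive_cosh s.
have d1 : is_derive s 1 (fun s => expR (cosh s - 1) - 1)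
    (expR (cosh s - 1) * sinh s).
  by apply: is_derive_eq; rewrite /GRing.scale/=; ring.
have V0 : 0 < expR (cosh s - 1) - 1 by rewrite subr_gt0 expR_gt1 cosh_sub1_gt0.
have d2 := @is_derive1_comp _ Num.sqrt (fun s => expR (cosh s - 1) - 1) s _ _
  (is_derive1_sqrt V0) d1.
by apply: (is_derive_eq d2); rewrite /vcosh' mulrC.
Qed.

Lemma continuous_cosh : continuous (@cosh R).
Proof.
move=> s; apply: differentiable_continuous; apply/derivable1_diffP.
by have := is_derive_cosh s; case.
Qed.

Lemma continuous_sinh : continuous sinh.
Proof.
move=> s; apply: cvgMl; apply: cvgB; first exact: continuous_expR.
by apply: continuous_comp; [exact: continuousN|exact: continuous_expR].
Qed.

Lemma continuous_vcosh : continuous vcosh.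
Proof.
move=> s; apply: continuous_comp; last exact: sqrt_continuous.
apply: cvgB; last exact: cvg_cst.
apply: continuous_comp; last exact: continuous_expR.
by apply: cvgB; [exact: continuous_cosh|exact: cvg_cst].
Qed.

Lemma continuous_vcosh' s : 0 < s -> {for s, continuous vcosh'}.
Proof.
move=> s0; apply: cvgM.
  apply: cvgM.
    apply: continuous_comp; last exact: continuous_expR.
    by apply: cvgB; [exact: continuous_cosh|exact: cvg_cst].
  apply: cvgMl; apply: cvgB; first exact: continuous_expR.
  by apply: continuous_comp; [exact: continuousN|exact: continuous_expR].
apply: cvgV; first by rewrite mulf_neq0// gt_eqF// vcosh_gt0.
by apply: cvgM; [exact: cvg_cst|exact: continuous_vcosh].
Qed.

Lemma vcosh0 : vcosh 0 = 0.
Proof. by rewrite /vcosh /cosh oppr0 expR0 divff// subrr expR0 subrr sqrtr0. Qed.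

Lemma cvg_vcoshy : vcosh s @[s --> +oo] --> +oo.
Proof.
apply/cvgryPge => A; near=> s.
have s0 : 0 <= s by near: s; apply: nbhs_pinfty_ge; exact: num_real.
have sA : 4 * A <= s by near: s; apply: nbhs_pinfty_ge; exact: num_real.
(* vcosh^2 s >= cosh s - 1 >= s^2 / 8 >= (s / 4)^2 *)
apply: (@le_trans _ _ (s / 4)); first by lra.
rewrite -(@ler_pXn2r _ 2%N)// ?nnegrE ?sqrtr_ge0 ?divr_ge0//.
rewrite sqr_vcosh//; have := cosh_sub1_ge _ s0; have := expR_ge1Dx (cosh s - 1).
have -> : (s / 4) ^+ 2 = s ^+ 2 / 16 by field.
have := sqr_ge0 s; lra.
Unshelve. all: by end_near.
Qed.

Lemma wallis_vcosh x :
  (wallis (x + 1) = \int[mu]_(s in `]0%R, +oo[)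
    (expR (- x * (cosh s - 1)) * sinh s / (2 * vcosh s))%:E)%E.
Proof.
rewrite /wallis (ge0_integration_by_substitution_oy vcosh vcosh'
  (fun v => (1 + v ^+ 2) `^ (- (x + 1))) _ _ is_derive_vcosh).
- apply: eq_integral => s; rewrite inE/= in_itv/= andbT => s0.
  congr (_%:E); rewrite sqr_vcosh ?ltW// subrKC /vcosh' !mulrA.
  congr (_ * _ / _).
  by rewrite -expRM -expRD; congr (expR _ * _); ring.
- exact: vcosh_gt0.
- move=> s t s0 st.
  rewrite ltr_sqrt ?subr_gt0 ?expR_gt1 ?cosh_sub1_gt0 ?(lt_trans s0)//.
  by rewrite ltrD2r ltr_expR ltrD2r lt_cosh.
- exact: continuous_vcosh'.
- move=> s s0; apply: divr_ge0; apply: mulr_ge0 => //.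
  + exact/ltW/sinh_gt0.
  + exact: sqrtr_ge0.
- rewrite -[X in _ --> X]vcosh0; apply: cvg_at_right_filter.
  exact: continuous_vcosh.
- exact: cvg_vcoshy.
- move=> v v0.
  apply: (@continuous_comp R R R
    (fun v => 1 + v ^+ 2) (fun u => u `^ (- (x + 1))) v).
    by apply: cvgD; [exact: cvg_cst|exact: exprn_continuous].
  by apply: continuous_powR; rewrite ltr_wpDr ?sqr_ge0.
- by move=> v _; exact: powR_ge0.
Qed.

(** Squared, with c = cosh s - 1: this is 2 (c^2 + 2 c) < 4 (e^c - 1), the
    quadratic lower bound of the exponential at c. The constant 1 / sqrt 2 is the
    limit of the quotient as s tends to 0. *)
Lemma sinh_vcosh_lt s : 0 < s -> sinh s / (2 * vcosh s) < (Num.sqrt 2)^-1.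
Proof.
move=> s0.
have c0 := cosh_sub1_gt0 _ s0.
have V0 := vcosh_gt0 _ s0; have r0 : 0 < Num.sqrt 2 :> R by rewrite sqrtr_gt0.
rewrite ltr_pdivrMr ?mulr_gt0// mulrC ltr_pdivlMr//.
rewrite -(@ltr_pXn2r _ 2%N)// ?nnegrE; last 2 first.
- by apply: mulr_ge0; apply: ltW => //; exact: sinh_gt0.
- by apply: mulr_ge0 => //; exact: ltW.
rewrite [(sinh s * _) ^+ 2]exprMn [(2 * _) ^+ 2]exprMn sqr_sinh.
by rewrite sqr_sqrtr// sqr_vcosh ?ltW//; have := expR_gt_quadratic _ c0; lra.
Qed.

Lemma measurable_besselK0_integrand x :
  measurable_fun setT (fun s : R => expR (- x * cosh s)).
Proof.
apply: continuous_measurable_fun => s; apply: continuous_comp.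
  by apply: cvgMr; exact: continuous_cosh.
exact: continuous_expR.
Qed.

Lemma besselK0E x : besselK0 x =
  fine (\int[mu]_(s in `]0%R, +oo[) (expR (- x * cosh s))%:E)%E.
Proof.
rewrite /besselK0 /Rintegral integral_itv_obnd_cbnd//.
apply/measurable_EFinP/measurable_funTS.
exact: measurable_besselK0_integrand.
Qed.

(** The comparison function e^(-x s^2 / 8) comes from [cosh_sub1_ge]. Finiteness
    is what makes [besselK0], a real number, agree with the extended integral. *)
Lemma integral_besselK0_lty x : 0 < x ->
  (\int[mu]_(s in `]0%R, +oo[) (expR (- x * cosh s))%:E < +oo)%E.
Proof.
move=> x0; have x80 : 0 < x / 8 by rewrite divr_gt0.
apply: (@le_lt_trans _ _
  (\int[mu]_(s in `]0%R, +oo[) (expR (- (x / 8 * s ^+ 2)))%:E)%E).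
  apply: ge0_le_integral => //=.
  - apply/measurable_EFinP/measurable_funTS.
    exact: measurable_besselK0_integrand.
  - apply/measurable_EFinP/measurableT_comp => //; apply: measurableT_comp => //.
    by apply: measurable_funM => //; exact: exprn_measurable.
  - move=> s; rewrite in_itv/= andbT => s0; rewrite lee_fin ler_expR.
    have := cosh_sub1_ge _ (ltW s0); have := sqr_ge0 s; nra.
by rewrite gauss_scale// ltry.
Qed.

Lemma wallis_lt_besselK0 x : 0 < x ->
  (wallis (x + 1) < (expR x / Num.sqrt 2 * besselK0 x)%:E)%E.
Proof.
move=> x0; rewrite wallis_vcosh EFinM besselK0E fineK; last first.
  rewrite ge0_fin_numE ?integral_besselK0_lty//.
  by apply: integral_ge0 => s _; rewrite lee_fin expR_ge0.
have k0 : 0 <= expR x / Num.sqrt 2 by rewrite divr_ge0 ?expR_ge0 ?sqrtr_ge0.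
have mK : measurable_fun (`]0%R, +oo[ : set R)
    (fun s : R => expR (- x * cosh s)).
  by apply/measurable_funTS; exact: measurable_besselK0_integrand.
have scaleE : ((expR x / Num.sqrt 2)%:E *
    \int[mu]_(s in `]0%R, +oo[) (expR (- x * cosh s))%:E =
    \int[mu]_(s in `]0%R, +oo[)
      (expR x / Num.sqrt 2 * expR (- x * cosh s))%:E)%E.
  by rewrite -ge0_integralZl//; exact/measurable_EFinP.
rewrite scaleE; apply: lt_integral => //.
- by rewrite [ltRHS]lebesgue_measure_itv/= ltry addye// ltry.
- apply: measurable_fun_continuous_oy => s s0.
  apply: cvgM.
    apply: cvgM; last exact: continuous_sinh.
    apply: continuous_comp; last exact: continuous_expR.
    apply: cvgMr; apply: cvgB; [exact: continuous_cosh|exact: cvg_cst].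
  apply: cvgV; first by rewrite mulf_neq0// gt_eqF// vcosh_gt0.
  by apply: cvgM; [exact: cvg_cst|exact: continuous_vcosh].
- exact: measurable_funM.
- move=> s /=; rewrite in_itv/= andbT => s0; apply/andP; split.
    by apply: divr_ge0; apply: mulr_ge0;
      rewrite ?expR_ge0 ?sqrtr_ge0// ltW ?sinh_gt0.
  have -> : expR x / Num.sqrt 2 * expR (- x * cosh s) =
      expR (- x * (cosh s - 1)) / Num.sqrt 2.
    by rewrite mulrAC -expRD; congr (expR _ / _); ring.
  by rewrite -mulrA ltr_pM2l ?expR_gt0// sinh_vcosh_lt.
- by rewrite -scaleE lte_mul_pinfty ?lee_fin// integral_besselK0_lty.
Qed.

End wallis_bessel.

Theorem theorem3p3 (R : realType) (x : R) (hx : 0 < x) :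
  Gamma (x + 1 / 2) / Gamma (x + 1)
    < Num.sqrt (2 / pi) * expR x * besselK0 x.
Proof.
have jlt := wallis_lt_besselK0 x hx.
have := gammaE_wallis (x + 1).
have J0 : (0 <= wallis (x + 1))%E.
  by apply: integral_ge0 => v _; rewrite lee_fin powR_ge0.
rewrite !GammaE (_ : x + 1 - 2^-1 = x + 1 / 2); last by field.
case: (wallis (x + 1)) jlt J0 => [j| |]//; rewrite lte_fin lee_fin => jlt j0.
have pi0 : 0 < Num.sqrt pi :> R by rewrite sqrtr_gt0 pi_gt0.
have s20 : 0 < Num.sqrt 2 :> R by rewrite sqrtr_gt0.
have rhsE : Num.sqrt (2 / pi) * expR x * besselK0 x =
    2 / Num.sqrt pi * (expR x / Num.sqrt 2 * besselK0 x).
  rewrite sqrtrM// sqrtrV ?pi_ge0//.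
  rewrite -[X in _ = X / _ * _](sqr_sqrtr (ler0n R 2)).
  by field; rewrite !gt_eqF.
move=> H; rewrite rhsE.
have sj0 : 0 <= 2 / Num.sqrt pi * j by rewrite mulr_ge0// divr_ge0// ltW.
apply: (@le_lt_trans _ _ (2 / Num.sqrt pi * j)); last first.
  by rewrite ltr_pM2l// divr_gt0.
(* An infinite or vanishing Gamma integral has real value 0 or quotient 0, since
   1 / 0 = 0; in these cases 0 <= (2 / sqrt pi) j suffices. *)
case: (gammaE (x + 1)) H => [g1 H| |]; rewrite /= ?invr0 ?mulr0//.
case: (gammaE (x + 1 / 2)) H => [g0| |]; rewrite /= ?mul0r// => -[H].
have [->|g10] := eqVneq g1 0; first by rewrite invr0 mulr0.
rewrite le_eqVlt; apply/orP; left; apply/eqP.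
have -> : g0 = g1 * j * (2 / Num.sqrt pi) by rewrite H; field; rewrite gt_eqF.
by field; rewrite g10 gt_eqF.
Qed.
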